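(* Let $n\ge 3$ be an integer, $m=\frac{n-2}{n+2}$, $\eta>0$, $\beta>0$ and $\alpha=\frac{2\beta}{1-m}$. Let $g_{ij}=v^{\frac{4}{n+2}}dx^2$ be the metric on $\mathbb{R}^n$ of a locally conformally flat gradient steady Yamabe soliton, where $v$ is the radially symmetric solution of $$\frac{n-1}{m}\Delta v^m+\alpha v+\beta x\cdot\nabla v=0,\quad v>0,\quad\text{in }\mathbb{R}^n,\qquad v(0)=\eta.$$ Then $g_{ij}$ has the exact decay rate $$\lim_{|x|\to\infty}\frac{|x|^2v(x)^{1-m}}{\log|x|}=\frac{(n-1)(n-2)}{\beta}.$$
   Context: $dx^2$ is the standard Euclidean metric on $\mathbb{R}^n$. In this setting, a (radially symmetric) locally conformally flat gradient steady Yamabe soliton on $\mathbb{R}^n$ is a metric $g_{ij}=v^{\frac{4}{n+2}}dx^2$ whose conformal factor $v$ is a radially symmetric (depending only on $|x|$) positive classical solution of the displayed equation with $m=\frac{n-2}{n+2}$ and $\alpha=\frac{2\beta}{1-m}$, $\beta>0$. The radially symmetric solution exists and is unique. *)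

(* Defs.v *)
From HB Require Import structures.
From mathcomp Require Import all_boot all_order all_algebra.
From mathcomp Require Import all_classical all_reals all_analysis.

Set Implicit Arguments.
Unset Strict Implicit.
Unset Printing Implicit Defensive.

Import Order.TTheory GRing.Theory Num.Theory.
Import numFieldNormedType.Exports.

Local Open Scope classical_set_scope.
Local Open Scope ring_scope.

Definition edot (R : realType) (n : nat) (x y : 'rV[R]_n) : R :=
  \sum_(i < n) x 0 i * y 0 i.

(* The library norm `|x| on 'rV[R]_n is the sup norm (same topology), so the
   Euclidean norm |x| is defined separately. *)
Definition enorm (R : realType) (n : nat) (x : 'rV[R]_n) : R :=
  Num.sqrt (edot x x).

Definition partial (R : realType) (n : nat) (i : 'I_n) (u : 'rV[R]_n -> R) :
    'rV[R]_n -> R :=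
  'D_(delta_mx 0 i) u.

Definition grad (R : realType) (n : nat) (u : 'rV[R]_n -> R) (x : 'rV[R]_n) :
    'rV[R]_n :=
  \row_(i < n) partial i u x.

Definition laplacian (R : realType) (n : nat) (u : 'rV[R]_n -> R)
    (x : 'rV[R]_n) : R :=
  \sum_(i < n) partial i (partial i u) x.

Definition is_C1 (R : realType) (n : nat) (u : 'rV[R]_n -> R) : Prop :=
  [/\ continuous u,
      forall (i : 'I_n) (x : 'rV[R]_n), derivable u x (delta_mx 0 i)
    & forall i : 'I_n, continuous (partial i u)].

Definition is_C2 (R : realType) (n : nat) (u : 'rV[R]_n -> R) : Prop :=
  is_C1 u /\ forall i : 'I_n, is_C1 (partial i u).

Definition radially_symmetric (R : realType) (n : nat) (u : 'rV[R]_n -> R) :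
    Prop :=
  forall x y : 'rV[R]_n, enorm x = enorm y -> u x = u y.

(* The filter "|x| -> oo" on R^n. *)
Definition at_infinity (R : realType) (n : nat) : set_system 'rV[R]_n :=
  filter_from [set: R] (fun M => [set x | M < enorm x]).
Arguments at_infinity {R n}.

Global Instance at_infinity_filter (R : realType) (n : nat) :
  Filter (@at_infinity R n).
Proof.
apply: filter_fromT_filter; first by exists 0.
move=> M N; exists (Num.max M N) => x /=.
by rewrite gt_max => /andP[].
Qed.

Record radial_solution (R : realType) (n : nat) (m alpha beta : R)
    (v : 'rV[R]_n -> R) : Prop := RadialSolution {
  rsol_C2 : is_C2 v;
  rsol_gt0 : forall x, 0 < v x;
  rsol_radial : radially_symmetric v;
  rsol_eq : forall x,
    (n%:R - 1) / m * laplacian (fun y => v y `^ m) x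
      + alpha * v x + beta * edot x (grad v x) = 0
}.

(* The metric v^(4/(n+2)) dx^2, as the field of its matrices (g_ij(x)). *)
Definition conformally_flat_metric (R : realType) (n : nat)
    (v : 'rV[R]_n -> R) (x : 'rV[R]_n) : 'M[R]_n :=
  (v x `^ (4 / (n%:R + 2)))%:M.

(* Main.v *)
Require Import Defs.
From HB Require Import structures.
From mathcomp Require Import all_boot all_order all_algebra.
From mathcomp Require Import all_classical all_reals all_analysis.
From mathcomp Require Import ring lra.

Set Implicit Arguments.
Unset Strict Implicit.
Unset Printing Implicit Defensive.

Import Order.TTheory GRing.Theory Num.Theory.
Import numFieldNormedType.Exports.

Local Open Scope classical_set_scope.
Local Open Scope ring_scope.

(** Along a ray the solution is a function phi of t = |x|, and the equation
    becomes an ordinary differential equation.  Put V = phi `^ (1 - m), let l be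
    the logarithmic derivative of phi, and set
      W = t ^+ 2 * V,   b = t * l,   rate = 2 + (1 - m) * b,
    so that W is the quantity whose growth is wanted.  With s = ln t and
    ka = beta / ((1 - m) (n - 1)) the equation is the autonomous system
      dW/ds = W rate,
      db/ds = - m b^2 - (n - 2) b - ka W rate.
    Two barrier arguments starting at t = 0 give b <= 0 (tl_le0) and
    0 <= rate (rate_ge0), so b stays bounded and 0 <= rate <= 2.

    The point is that b + ka W almost grows linearly: the terms in W cancel from
    its derivative, and for m = (n - 2) / (n + 2) completing the square leaves
      d(b + ka W)/ds = K - (D / 2) rate^2,   K = (n^2 - 4) / 4,   D = K / 2.
    Dropping the square and using that b is bounded gives
    ka W <= K s + O(1).  Conversely rate^2 <= 2 rate, and rate is the derivative
    of ln W; so b + ka W + D ln W grows at least like K s, while the upper bound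
    just obtained makes ln W of size O(ln s).  Hence W / s tends to K / ka
    (cvg_t2V_div_ln), and K / ka = (n - 1) (n - 2) / beta.

    The passage from R^n to the ray (laplacian_radial) only ever differentiates
    functions of one variable: a second partial derivative at a point is the
    second derivative along the coordinate line through it. *)

(** * Monotonicity and barriers *)

Lemma derive_le0_nincr (R : realType) (f df : R -> R) (a b : R) :
  a <= b ->
  (forall x : R, a <= x <= b -> is_derive x 1 f (df x)) ->
  (forall x : R, a < x <= b -> df x <= 0) ->
  f b <= f a.
Proof.
rewrite le_eqVlt => /predU1P[->//|ab] fd df0.
have [x xab|x xab|c cab fE] := @MVT R f df a b ab.
- by apply: fd; move: xab; rewrite in_itv /= => /andP[/ltW -> /ltW ->].
- apply: derivable_within_continuous x xab => x xab.
  by apply: (@ex_derive _ _ _ _ _ _ (df x)); apply: fd; rewrite in_itv in xab.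
- rewrite -subr_le0 fE; apply: mulr_le0_ge0; last by rewrite subr_ge0 ltW.
  by apply: df0; move: cab; rewrite in_itv /= => /andP[-> /ltW ->].
Qed.

(** After the last time before x at which f <= 0, f would be positive, hence
    nonincreasing, and could not have become positive. *)
Lemma le0_barrier (R : realType) (f df : R -> R) :
  (forall x : R, 0 <= x -> is_derive x 1 f (df x)) ->
  (forall x : R, 0 < x -> 0 < f x -> df x <= 0) ->
  f 0 <= 0 ->
  forall x : R, 0 <= x -> f x <= 0.
Proof.
move=> fd df0 f00 r r0; rewrite leNgt; apply/negP => fr0.
pose S := [set t | 0 <= t <= r /\ f t <= 0].
have S0 : S 0 by split => //; rewrite lexx.
have Sr : ubound S r by move=> t [/andP[]].
have hS : has_sup S by split; [exists 0 | exists r].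
have ub := ub_le_sup hS.2.
have s0 : 0 <= sup S by exact: ub.
have sr : sup S <= r by exact: (ge_sup (ex_intro _ 0 S0) Sr).
have fs0 : f (sup S) <= 0.
  rewrite leNgt; apply/negP => fs0.
  have cf : {for sup S, continuous f}.
    apply/differentiable_continuous/derivable1_diffP.
    exact: (@ex_derive _ _ _ _ _ _ _ (fd _ s0)).
  have /nbhs_ballP[e /= e0 be] : \forall y \near sup S, 0 < f y.
    exact: (@cvgr_gt _ _ _ _ f (f (sup S)) cf 0 fs0).
  have [y Sy ey] := sup_adherent e0 hS.
  have : 0 < f y.
    apply: be; rewrite /ball /= ger0_norm ?subr_ge0 ?ub//.
    by rewrite ltrBlDr -ltrBlDl.
  by case: Sy => _; rewrite leNgt => /negP.
have : f r <= f (sup S).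
  apply: (@derive_le0_nincr _ _ df) => // x /andP[sx xr].
    by apply: fd; apply: le_trans sx.
  have x0 : 0 < x by apply: le_lt_trans sx.
  apply: df0 => //; rewrite ltNge; apply/negP => fx0.
  have : x <= sup S by apply: ub; split => //; rewrite ltW.
  by rewrite leNgt sx.
by rewrite leNgt (le_lt_trans fs0 fr0).
Qed.

(** * Asymptotics up to a logarithmic error *)

Lemma cvg_div_ln (R : realType) (f : R -> R) (L C : R) :
  (forall t, expR 1 <= t -> `|f t - L * ln t| <= C * Num.sqrt (ln t)) ->
  (f t / ln t) @[t --> +oo] --> L.
Proof.
move=> fL; apply/cvgrPdist_le => e e0.
(* Past this threshold 1 <= ln t and C / e <= sqrt (ln t). *)
exists (expR (1 + (C / e) ^+ 2)); split; first exact: num_real.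
move=> t tM.
have t0 : 0 < t by rewrite (lt_trans _ tM)// expR_gt0.
have s_ge : 1 + (C / e) ^+ 2 <= ln t.
  by rewrite -[leLHS]expRK ler_ln ?posrE ?expR_gt0// ltW.
have Ce0 := sqr_ge0 (C / e).
have s1 : 1 <= ln t by lra.
have s0 : 0 < ln t by lra.
rewrite distrC.
have -> : f t / ln t - L = (f t - L * ln t) / ln t by field; rewrite gt_eqF.
rewrite normrM normfV (gtr0_norm s0) ler_pdivrMr//.
have /fL/le_trans : expR 1 <= t.
  by rewrite -[leRHS]lnK ?posrE// ler_expR.
apply.
rewrite -[in leRHS](sqr_sqrtr (ltW s0)) expr2 mulrA ler_wpM2r ?sqrtr_ge0//.
rewrite -ler_pdivrMl// mulrC (le_trans (ler_norm _))// -sqrtr_sqr ler_wsqrtr//.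
lra.
Qed.

Lemma ln_le_sqrt (R : realType) (x : R) : 0 < x -> ln x <= 2 * Num.sqrt x.
Proof.
move=> x0; have q0 : 0 < Num.sqrt x by rewrite sqrtr_gt0.
rewrite -[in leLHS](sqr_sqrtr (ltW x0)) lnXn// mulr2n.
by have := ln_sublinear q0; lra.
Qed.

(** The upper bound forces W = O(ln t), which turns the ln W in the lower bound
    into O(ln (ln t)); the cruder sqrt (ln t) is all that is kept of it. *)
Lemma cvg_div_ln_of_log_defect (R : realType) (W : R -> R) (K ka D C1 C2 : R) :
  0 < K -> 0 < ka -> 0 <= D ->
  (forall t, 1 <= t -> 0 < W t) ->
  (forall t, 1 <= t -> ka * W t <= C1 + K * ln t) ->
  (forall t, 1 <= t -> K * ln t - C2 <= ka * W t + D * ln (W t)) ->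
  (W t / ln t) @[t --> +oo] --> K / ka.
Proof.
move=> K0 ka0 D0 W0 upW loW.
pose A := (`|C1| + K) / ka.
have A0 : 0 < A by rewrite divr_gt0// ltr_wpDl.
pose C := `|C1| + `|C2 + D * ln A| + 2 * D.
apply: (@cvg_div_ln _ _ _ (C / ka)) => t te.
have t1 : 1 <= t by rewrite (le_trans _ te)// -[leLHS]expR0 ler_expR.
have t0 : 0 < t by rewrite (lt_le_trans _ t1).
have s1 : 1 <= ln t by rewrite -[leLHS]expRK ler_ln ?posrE// expR_gt0.
have := upW _ t1; have := loW _ t1; have := W0 _ t1.
move: s1; set s := ln t => s1 Wt0 lo up.
set q := Num.sqrt s.
have s0 : 0 < s by lra.
have q1 : 1 <= q by rewrite -[leLHS]sqrtr1 ler_wsqrtr.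
have WA : W t <= A * s.
  rewrite /A mulrAC ler_pdivlMr// mulrC (le_trans up)// mulrDl lerD2r.
  by rewrite (le_trans (ler_norm _))// ler_peMr.
have lnW : ln (W t) <= ln A + 2 * q.
  have : ln (W t) <= ln (A * s) by rewrite ler_ln ?posrE// mulr_gt0.
  rewrite lnM ?posrE// => /le_trans; apply.
  by rewrite lerD2l ln_le_sqrt.
have DlnW : D * ln (W t) <= D * (ln A + 2 * q) by rewrite ler_wpM2l.
have -> : W t - K / ka * s = (ka * W t - K * s) / ka by field; rewrite gt_eqF.
rewrite normrM normfV (gtr0_norm ka0) mulrAC.
apply: ler_wpM2r; first by rewrite invr_ge0 ltW.
have C1q : `|C1| <= `|C1| * q by rewrite ler_peMr.
have C2q : `|C2 + D * ln A| <= `|C2 + D * ln A| * q by rewrite ler_peMr.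
have := ler_norm C1; have := ler_norm (C2 + D * ln A).
have D0q : 0 <= D * q by rewrite mulr_ge0// (le_trans _ q1).
have n1 := normr_ge0 C1; have n2 := normr_ge0 (C2 + D * ln A).
move=> C2le C1le; rewrite ler_norml /C; apply/andP; split; nra.
Qed.

(** * Differentiation rules *)

(** The rules for products, sums and scalings with the operation applied
    pointwise and the value of the derivative left to a separate equation. *)
Lemma is_derive_mul (R : realType) (f g : R -> R) (x df dg d : R) :
  is_derive x 1 f df -> is_derive x 1 g dg ->
  d = df * g x + f x * dg ->
  is_derive x 1 (fun t => f t * g t) d.
Proof.
move=> fd gd ->; rewrite addrC [df * _]mulrC; exact: is_deriveM.
Qed.

Lemma is_derive_add (R : realType) (f g : R -> R) (x df dg d : R) :
  is_derive x 1 f df -> is_derive x 1 g dg ->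
  d = df + dg ->
  is_derive x 1 (fun t => f t + g t) d.
Proof. by move=> fd gd ->; exact: is_deriveD. Qed.

Lemma is_derive_scale (R : realType) (f : R -> R) (c x df d : R) :
  is_derive x 1 f df -> d = c * df ->
  is_derive x 1 (fun t => c * f t) d.
Proof. by move=> fd ->; exact: is_deriveZ. Qed.

Lemma is_derive_powR (R : realType) (f : R -> R) (a x df : R) :
  0 < f x -> is_derive x 1 f df ->
  is_derive x 1 (fun t => f t `^ a) (a * (df / f x) * f x `^ a).
Proof.
move=> f0 fd; have -> : a * (df / f x) * f x `^ a = a * f x `^ (a - 1) * df.
  rewrite powRB ?(gt_eqF f0) ?implybT// powRr1; last exact: ltW.
  by field; rewrite gt_eqF.
exact: (@is_derive1_comp R (fun y => y `^ a) f x _ _ (is_derive1_powR a f0) fd).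
Qed.

(** * The radial equation *)

(** Here l is the logarithmic derivative of a positive function phi, and UD and VD
    say that U and V are the powers of phi of exponents m and 1 - m, up to
    constant factors. *)
Section RadialEquation.
Variables (R : realType) (N m ka : R).
Hypotheses (N2 : 2 < N) (mE : m = (N - 2) / (N + 2)) (ka0 : 0 < ka).
Variables (l dl U V : R -> R).
Let rate (t : R) : R := 2 + (1 - m) * (t * l t).
Hypotheses (U0 : forall t, 0 < U t) (V0 : forall t, 0 < V t).
Hypothesis lD : forall t : R, is_derive t 1 l (dl t).
Hypothesis UD : forall t : R, is_derive t 1 U (m * l t * U t).
Hypothesis VD : forall t : R, is_derive t 1 V ((1 - m) * l t * V t).
Hypothesis ode : forall t, 0 < t ->
  dl t = - m * l t ^+ 2 - (N - 1) * (l t / t) - ka * V t * rate t.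

Let m0 : 0 < m.
Proof. by rewrite mE; have := N2 => ?; apply: divr_gt0; lra. Qed.
Let m1 : 0 < 1 - m.
Proof.
have N2' := N2; have -> : 1 - m = 4 / (N + 2) by rewrite mE; field; lra.
by apply: divr_gt0; lra.
Qed.

Let bD (t : R) : is_derive t 1 (fun t => t * l t) (l t + t * dl t).
Proof. by apply: is_derive_mul; rewrite ?mul1r. Qed.

Let tdl t : 0 < t ->
  t * dl t = - m * l t * (t * l t) - (N - 1) * l t - ka * V t * rate t * t.
Proof. by move=> t0; rewrite ode//; field; rewrite gt_eqF. Qed.

(** Where t * l t > 0, every term of the equation pushes it down. *)
Lemma tl_le0 t : 0 <= t -> t * l t <= 0.
Proof.
apply: (le0_barrier (f := fun t => t * l t)
    (df := fun t => l t + t * dl t)) => [{}t _|{}t t0 tl0|].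
- exact: bD.
- rewrite tdl//; have l0 : 0 < l t by rewrite pmulr_rgt0 in tl0.
  have rate0 : 0 < rate t by have := mulr_gt0 m1 tl0; rewrite /rate; lra.
  have p1 : 0 < ka * V t * rate t * t by rewrite !mulr_gt0.
  have p2 : 0 < m * l t * (t * l t) by rewrite !mulr_gt0.
  have p3 : 0 < (N - 2) * l t by rewrite mulr_gt0// subr_gt0.
  lra.
- by rewrite mul0r.
Qed.

(** The barrier argument is run on U * rate, a positive multiple of the derivative
    of t `^ ((N - 2) / 2) * U: the weight U cancels the term m * l ^+ 2, which
    has the wrong sign when rate is very negative. *)
Lemma rate_ge0 t : 0 <= t -> 0 <= rate t.
Proof.
have N2' := N2.
move=> t0; rewrite -(pmulr_rge0 _ (U0 t)) -oppr_le0 -mulN1r; move: t t0.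
pose dUrate t := m * l t * U t * rate t + U t * ((1 - m) * (l t + t * dl t)).
apply: (le0_barrier (f := fun t => -1 * (U t * rate t))
    (df := fun t => -1 * dUrate t)) => [t _|t t0 Urate0|].
- apply: is_derive_scale (erefl _); apply: is_derive_mul (UD t) _ (erefl _).
  eapply is_derive_add; first exact: is_derive_cst.
    exact: is_derive_scale (bD t) (erefl _).
  by rewrite add0r.
- have rate0 : rate t < 0 by move: Urate0; rewrite mulN1r oppr_gt0 pmulr_rlt0.
  have tl0 : t * l t < 0.
    by have := rate0; rewrite -(pmulr_rlt0 (t * l t) m1) /rate; lra.
  have l0 : l t < 0 by rewrite pmulr_rlt0 in tl0.
  have -> : -1 * dUrate t =
      U t * (2 * m * l t + (1 - m) * (ka * V t * t) * rate t).
    rewrite /dUrate tdl// /rate mE; field; lra.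
  rewrite pmulr_rle0//; have p1 : 0 < (1 - m) * (ka * V t * t).
    by rewrite !mulr_gt0.
  have p2 : (1 - m) * (ka * V t * t) * rate t < 0 by rewrite pmulr_rlt0.
  have p3 : m * l t < 0 by rewrite pmulr_rlt0.
  lra.
- rewrite /rate mul0r mulr0 addr0 mulN1r oppr_le0.
  by apply: mulr_ge0 => //; exact: ltW.
Qed.

Lemma cvg_t2V_div_ln :
  (t ^+ 2 * V t / ln t) @[t --> +oo] --> (N ^+ 2 - 4) / (4 * ka).
Proof.
pose W t := t ^+ 2 * V t.
have W0 t : 0 < t -> 0 < W t by move=> t0; rewrite mulr_gt0// exprn_gt0.
have tgt0 (t : R) : 1 <= t -> 0 < t by apply: lt_le_trans.
have WD (t : R) : 0 < t -> is_derive t 1 W (W t * rate t / t).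
  move=> t0; eapply is_derive_mul; [|exact: VD|].
    exact: (is_derive_mul (is_derive_id t 1) (is_derive_id t 1) (erefl _)).
  by rewrite /W /rate /=; field; rewrite gt_eqF.
have lnD (t : R) : 0 < t -> is_derive t 1 (@ln R) t^-1 by exact: is_derive1_ln.
have lnWD (t : R) : 0 < t -> is_derive t 1 (fun t => ln (W t)) (rate t / t).
  move=> t0; have -> : rate t / t = (W t)^-1 * (W t * rate t / t).
    by field; rewrite !gt_eqF// W0.
  exact: is_derive1_comp (is_derive1_ln (W0 t t0)) (WD t t0).
(* K is the slope of ka * W in ln t; D / 2 is the coefficient of rate ^+ 2. *)
pose K := (N ^+ 2 - 4) / 4.
pose D := (N ^+ 2 - 4) / 8.
have -> : (N ^+ 2 - 4) / (4 * ka) = K / ka by rewrite /K; field; rewrite gt_eqF.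
have N2' := N2.
have NN : 0 < N ^+ 2 - 4 by nra.
have D0 : 0 <= D / 2 by rewrite /D; lra.
(* For this m the quadratic m b^2 + (N - 2) b + K is a perfect square. *)
have defect t : 0 < t -> t * (l t + t * dl t) + ka * (W t * rate t) =
    K - D / 2 * rate t ^+ 2.
  by move=> t0; rewrite tdl// /K /D /W /rate mE; field; lra.
have FD (t : R) : 0 < t ->
    is_derive t 1 (fun t => (t * l t + ka * W t) + - K * ln t)
    (- (D / 2 * rate t ^+ 2) / t).
  move=> t0.
  eapply is_derive_add.
  - eapply is_derive_add; [exact: bD| |reflexivity].
    exact: is_derive_scale (WD t t0) (erefl _).
  - exact: is_derive_scale (lnD t t0) (erefl _).
  have -> : - (D / 2 * rate t ^+ 2) =
     t * (l t + t * dl t) + ka * (W t * rate t) - K by rewrite defect//; lra.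
  by field; rewrite gt_eqF.
pose F t := (t * l t + ka * W t) + - K * ln t.
have b_le0_rate_ge0 t : 1 <= t -> t * l t <= 0 <= rate t.
  move=> t1; have t0 := tgt0 _ t1.
  by rewrite tl_le0 ?rate_ge0// ltW.
have Fle t : 1 <= t -> F t <= F 1.
  move=> t1; apply: (derive_le0_nincr (f := F)
    (df := fun t => - (D / 2 * rate t ^+ 2) / t)).
  - exact: t1.
  - by move=> x /andP[x1 _]; apply: FD; apply: tgt0.
  - move=> x /andP[x1 _]; have x0 : 0 < x by rewrite tgt0// ltW.
    rewrite mulNr oppr_le0; apply: divr_ge0; last exact: ltW.
    by apply: mulr_ge0 => //; exact: sqr_ge0.
(* - G adds D * ln (W t) to F, which absorbs the defect D / 2 * rate ^+ 2 since
   rate <= 2. *)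
pose G t := - 1 * F t + - D * ln (W t).
have Gle t : 1 <= t -> G t <= G 1.
  move=> t1; apply: (derive_le0_nincr (f := G)
    (df := fun t => D / 2 * (rate t * (rate t - 2)) / t)).
  - exact: t1.
  - move=> x /andP[x1 _]; have x0 := tgt0 _ x1.
    eapply is_derive_add; first exact: is_derive_scale (FD x x0) (erefl _).
      exact: is_derive_scale (lnWD x x0) (erefl _).
    by field; rewrite gt_eqF.
  - move=> x /andP[x1 _]; have x0 : 0 < x by rewrite tgt0// ltW.
    have /andP[tl rt] := b_le0_rate_ge0 _ (ltW x1).
    rewrite pmulr_lle0 ?invr_gt0//; apply: mulr_ge0_le0 => //.
    apply: mulr_ge0_le0 => //; have := m1; rewrite /rate; nra.
apply: (@cvg_div_ln_of_log_defect _ W K ka D (F 1 + 2 / (1 - m)) (G 1)) => //.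
- by rewrite /K; lra.
- by rewrite /D; lra.
- by move=> t /tgt0/W0.
- move=> t t1; have /andP[tl] := b_le0_rate_ge0 _ t1; have := Fle _ t1.
  rewrite /F /rate => Ft Ht.
  (* rate >= 0 is the lower bound on t * l t. *)
  suff : - (2 / (1 - m)) <= t * l t by lra.
  rewrite lerNl ler_pdivlMr//; lra.
- move=> t t1; have /andP[tl _] := b_le0_rate_ge0 _ t1; have := Gle _ t1.
  by rewrite [G t]/G [F t]/F; lra.
Qed.

End RadialEquation.

(** * Radial functions on coordinate lines *)

Section Rays.
Variables (R : realType) (n : nat).
Implicit Types (u : 'rV[R]_n -> R) (x : 'rV[R]_n) (i : 'I_n).

(** With the base point moving along the line, this also covers second partial
    derivatives and leaves only calculus in one variable. *)
Lemma line_quotient u i x (t : R) :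
  (fun h : R => h^-1 *: ((u \o shift (x + t *: delta_mx 0 i))
     (h *: delta_mx 0 i) - u (x + t *: delta_mx 0 i))) =
  (fun h : R => h^-1 *: (((fun s : R => u (x + s *: delta_mx 0 i)) \o shift t)
     (h *: (1 : R)) - u (x + t *: delta_mx 0 i))).
Proof.
apply/funext => h /=.
by rewrite /shift /= scalerDl addrCA [h%:A]mulr1.
Qed.

Lemma partial_line u i x (t : R) :
  partial i u (x + t *: delta_mx 0 i) =
  'D_1 (fun s : R => u (x + s *: delta_mx 0 i)) t.
Proof. by rewrite /partial /derive line_quotient. Qed.

Lemma is_derive_line u i x (t : R) :
  derivable u (x + t *: delta_mx 0 i) (delta_mx 0 i) ->
  is_derive t 1 (fun s : R => u (x + s *: delta_mx 0 i))
    (partial i u (x + t *: delta_mx 0 i)).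
Proof.
rewrite /derivable line_quotient => du.
by apply: DeriveDef; rewrite ?partial_line.
Qed.

Lemma edot_ray i (t : R) x : edot (t *: delta_mx 0 i) x = t * x 0 i.
Proof.
rewrite /edot (bigD1 i)//= big1 ?addr0 => [|j ji]; rewrite !mxE eqxx /=.
  by rewrite eqxx mulr1.
by rewrite (negPf ji) mulr0 mul0r.
Qed.

Lemma enorm_ray i (t : R) : enorm (t *: delta_mx 0 i : 'rV[R]_n) = `|t|.
Proof. by rewrite /enorm edot_ray !mxE !eqxx mulr1 -expr2 sqrtr_sqr. Qed.

Lemma enorm_plane i j (t s : R) : j != i ->
  enorm (t *: delta_mx 0 i + s *: delta_mx 0 j : 'rV[R]_n) =
  Num.sqrt (t ^+ 2 + s ^+ 2).
Proof.
move=> ji; rewrite /enorm /edot; congr Num.sqrt.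
rewrite (bigD1 i)//= (bigD1 j)//= big1 ?addr0 => [|k /andP[ki kj]];
  rewrite !mxE !eqxx /=.
  rewrite (negPf ji) eq_sym (negPf ji).
  by rewrite !mulr0 !mulr1 addr0 add0r !expr2.
by rewrite (negPf ki) (negPf kj) !mulr0 addr0 mul0r.
Qed.

Lemma radial_ray u i x :
  radially_symmetric u -> u x = u (enorm x *: delta_mx 0 i).
Proof. by move=> ru; apply: ru; rewrite enorm_ray ger0_norm ?sqrtr_ge0. Qed.

(** Moving from t e_i in a direction e_j orthogonal to it, u is
    s |-> U (sqrt (t^2 + s^2)), with derivative U1 (rho) * (s / rho); the factor s
    vanishes at 0, so the second derivative there is U1 t / t.  Each of the n - 1
    orthogonal directions contributes this. *)
Lemma laplacian_radial u (U U1 U2 : R -> R) i (t : R) :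
  radially_symmetric u ->
  (forall s, u (s *: delta_mx 0 i) = U s) ->
  (forall s : R, is_derive s 1 U (U1 s)) ->
  (forall s : R, is_derive s 1 U1 (U2 s)) ->
  0 < t ->
  laplacian u (t *: delta_mx 0 i) = U2 t + (n%:R - 1) * (U1 t / t).
Proof.
move=> ru uU UD U1D t0.
rewrite /laplacian (bigD1 i)//=; congr (_ + _).
  have p1 s : partial i u (s *: delta_mx 0 i) = U1 s.
    rewrite -[_ *: _]add0r partial_line -[RHS](@derive_val _ _ _ _ _ _ _ (UD s)).
    by congr ('D_1 _ s); apply/funext => r; rewrite add0r.
  rewrite -[_ *: _]add0r partial_line -[RHS](@derive_val _ _ _ _ _ _ _ (U1D t)).
  by congr ('D_1 _ t); apply/funext => r; rewrite add0r.
pose rho (s : R) := Num.sqrt (t ^+ 2 + s ^+ 2).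
have ts0 s : 0 < t ^+ 2 + s ^+ 2.
  by rewrite ltr_wpDr ?sqr_ge0// exprn_gt0.
have rho0 s : 0 < rho s by rewrite sqrtr_gt0.
have rhoD (s : R) : is_derive s 1 rho (s / rho s).
  have sD : is_derive s 1 (fun s : R => t ^+ 2 + s ^+ 2) (2 * s).
    eapply is_derive_add; first exact: is_derive_cst.
      exact: (is_derive_mul (is_derive_id s 1) (is_derive_id s 1) (erefl _)).
    by rewrite /=; ring.
  have -> : s / rho s = (2 * rho s)^-1 * (2 * s) by field; rewrite gt_eqF.
  exact: (@is_derive1_comp R Num.sqrt (fun s => t ^+ 2 + s ^+ 2) s _ _
    (is_derive1_sqrt (ts0 s)) sD).
have pj j : j != i -> partial j (partial j u) (t *: delta_mx 0 i) = U1 t / t.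
  move=> ji.
  have p1 s : partial j u (t *: delta_mx 0 i + s *: delta_mx 0 j) =
      U1 (rho s) * (s / rho s).
    rewrite partial_line.
    have := @is_derive1_comp R U rho s _ _ (UD _) (rhoD s).
    move=> /(@derive_val _ _ _ _ _ _ _) <-.
    congr ('D_1 _ s); apply/funext => r /=.
    by rewrite (radial_ray i _ ru) uU enorm_plane.
  rewrite -[_ *: _]addr0 -[X in _ + X](scale0r (delta_mx 0 j)) partial_line.
  have rhot : rho 0 = t by rewrite /rho expr0n addr0 sqrtr_sqr gtr0_norm.
  have D1 : is_derive (0 : R) 1 (fun s => U1 (rho s))
      (U2 (rho 0) * (0 / rho 0)).
    exact: (@is_derive1_comp R U1 rho 0 _ _ (U1D _) (rhoD 0)).
  have D2 : is_derive (0 : R) 1 (fun s => (rho s)^-1)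
      (- (rho 0) ^- 2 *: (0 / rho 0)).
    by apply: is_deriveV; rewrite gt_eqF.
  have D3 := is_derive_mul (is_derive_id (0 : R) 1) D2 (erefl _).
  have D4 := is_derive_mul D1 D3 (erefl _).
  transitivity ('D_1 (fun s : R => U1 (rho s) * (s / rho s)) 0).
    by congr ('D_1 _ (0 : R)); apply/funext.
  rewrite (@derive_val _ _ _ _ _ _ _ D4) rhot /=.
  by rewrite /GRing.scale /=; field; rewrite gt_eqF.
rewrite (eq_bigr (fun=> U1 t / t)) => [|j ji]; last exact: pj.
rewrite big_const iter_addr_0 -[LHS]mulr_natl; congr (_ * _).
rewrite (_ : #|_| = n.-1); last first.
  by rewrite -[in RHS](card_ord n) -(cardC1 i); apply: eq_card => j.
by rewrite -subn1 natrB// (leq_trans _ (ltn_ord i)).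
Qed.

End Rays.

Lemma enorm_cvg_pinfty (R : realType) (n : nat) :
  enorm (x : 'rV[R]_n) @[x --> at_infinity] --> +oo.
Proof.
by apply/cvgryPgt => A; exists A.
Qed.

(** * Decay rate of the steady soliton *)

Theorem corollary2p4 (R : realType) (n : nat) (m eta beta alpha : R)
    (g : 'rV[R]_n -> 'M[R]_n) (v : 'rV[R]_n -> R)
    (hn : (3 <= n)%N)
    (hm : m = (n%:R - 2) / (n%:R + 2))
    (heta : 0 < eta)
    (hbeta : 0 < beta)
    (halpha : alpha = 2 * beta / (1 - m))
    (hg : g = conformally_flat_metric v)
    (hv : radial_solution m alpha beta v)
    (hv0 : v 0 = eta) :
  (enorm x ^+ 2 * v x `^ (1 - m) / ln (enorm x)) @[x --> at_infinity]
    --> (n%:R - 1) * (n%:R - 2) / beta.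
Proof.
pose i0 : 'I_n := Ordinal (leq_trans (isT : 0 < 3)%N hn).
pose e : 'rV[R]_n := delta_mx 0 i0.
have [[vC1 pvC1] v0 vrad veq] := hv.
have N2 : 2 < n%:R :> R by rewrite ltr_nat.
have mE : 1 - m = 4 / (n%:R + 2) by rewrite hm; field; lra.
have m0 : 0 < m by rewrite hm divr_gt0//; lra.
have m1 : 0 < 1 - m by rewrite mE divr_gt0//; lra.
pose phi (t : R) := v (t *: e).
pose phi1 (t : R) := partial i0 v (t *: e).
pose phi2 (t : R) := partial i0 (partial i0 v) (t *: e).
have lineE (u : 'rV[R]_n -> R) :
    (fun s : R => u (0 + s *: e)) = fun s => u (s *: e).
  by apply/funext => s; rewrite add0r.
have phiD (t : R) : is_derive t 1 phi (phi1 t).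
  have := @is_derive_line R n v i0 0 t; rewrite lineE add0r; apply.
  by case: vC1 => _ + _; apply.
have phi1D (t : R) : is_derive t 1 phi1 (phi2 t).
  have := @is_derive_line R n (partial i0 v) i0 0 t; rewrite lineE add0r; apply.
  by case: (pvC1 i0) => _ + _; apply.
have phi0 t : 0 < phi t by exact: v0.
pose l (t : R) := phi1 t / phi t.
pose dl (t : R) := phi2 t / phi t - l t ^+ 2.
have lD (t : R) : is_derive t 1 l (dl t).
  eapply is_derive_mul; first exact: phi1D.
    by apply: is_deriveV (phiD t); rewrite gt_eqF.
  by rewrite /dl /l /GRing.scale /=; field; rewrite gt_eqF.
pose U (t : R) := phi t `^ m.
have UD (t : R) : is_derive t 1 U (m * l t * U t) by exact: is_derive_powR.
have U1D (t : R) : is_derive t 1 (fun t => m * l t * U t)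
    (m * dl t * U t + m * l t * (m * l t * U t)).
  eapply is_derive_mul; [|exact: UD|reflexivity].
  exact: is_derive_scale (lD t) (erefl _).
pose V (t : R) := phi t `^ (1 - m).
have VD (t : R) : is_derive t 1 V ((1 - m) * l t * V t).
  exact: is_derive_powR.
have V0 t : 0 < V t by exact: powR_gt0.
have U0 t : 0 < U t by exact: powR_gt0.
have phiE t : phi t = U t * V t.
  rewrite /U /V -powRD ?(gt_eqF (phi0 t)) ?implybT//.
  by rewrite addrC subrK powRr1// ltW.
pose ka := beta / ((1 - m) * (n%:R - 1)).
have ka0 : 0 < ka by rewrite divr_gt0// mulr_gt0//; lra.
have urad : radially_symmetric (fun y => v y `^ m).
  by move=> x y xy; rewrite (vrad x y xy).
have ode (t : R) : 0 < t ->
    dl t = - m * l t ^+ 2 - (n%:R - 1) * (l t / t)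
           - ka * V t * (2 + (1 - m) * (t * l t)).
  move=> t0; have := veq (t *: e).
  rewrite (laplacian_radial urad _ UD U1D t0)// edot_ray mxE.
  rewrite -/(phi t) -/(phi1 t).
  have -> : phi1 t = l t * phi t by rewrite /l divfK// gt_eqF.
  rewrite phiE halpha /ka => Eq.
  have tN : t != 0 by rewrite gt_eqF.
  have UN : U t != 0 by rewrite gt_eqF.
  have mN : m != 0 by rewrite gt_eqF.
  have m1N : 1 - m != 0 by rewrite gt_eqF.
  have nN : n%:R - 1 != 0 :> R by rewrite gt_eqF//; lra.
  (* Multiplied by (n - 1) * U, the claim is the equation itself. *)
  apply/eqP; rewrite -subr_eq0; apply/eqP.
  apply: (mulfI (x := (n%:R - 1) * U t)); first by rewrite mulf_neq0.
  rewrite mulr0 -[RHS]Eq; field.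
  by rewrite tN mN nN m1N.
have lim1 := cvg_t2V_div_ln N2 hm ka0 U0 V0 lD UD VD ode.
have limE : (n%:R ^+ 2 - 4) / (4 * ka) = (n%:R - 1) * (n%:R - 2) / beta.
  rewrite /ka mE; field; rewrite !gt_eqF//; lra.
rewrite -limE.
have -> : (fun x => enorm x ^+ 2 * v x `^ (1 - m) / ln (enorm x)) =
    (fun t => t ^+ 2 * V t / ln t) \o @enorm R n.
  by apply/funext => x /=; rewrite (radial_ray i0 x vrad).
exact: cvg_comp (@enorm_cvg_pinfty R n) lim1.
Qed.
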